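(* Let $b,c,w_2$ be rational numbers such that $F(b,c)\neq 0$ and $Q_2(b,c)\neq 0$, such that $(b,c,w_2)$ lies on the surface $$D_2\,(w_2^2+3)^3+4\,(w_2-1)^2\,(1+w_2)^2=0,\qquad D_2=-\frac{P_2^2}{Q_2^3},$$ and such that $w_2\neq\pm 1$. Then there exists a rational number $\alpha_2$ such that $$w_2^2+3=Q_2\,\alpha_2^2,\qquad 2\,(w_2^2-1)=P_2\,\alpha_2^3 .$$
   Context: Define $F=b^2c^4-6b^2c^3+13b^2c^2-12b^2c+4b^2+c^2$, $$Q_2=\tfrac{3}{2}\,(6b^4c^4-36b^4c^3+78b^4c^2-72b^4c+24b^4-12b^3c^4+36b^3c^3-72b^3c+48b^3+5b^2c^4+16b^2c^3-68b^2c^2+32b^2c+20b^2-12bc^3+24bc+6c^2),$$ and $P_2=\dfrac{b\,N_2}{2F}$, where $N_2=832b^2c^2-1440b^2c^4-840b^2c^3+4788b^3c^4+396bc^3+720b^3c+808b^4c^4+3032b^4c^3-2576b^4c^2-96b^4c+448b^4-504bc^4-4176b^3c^3-9b^3c^8+72b^3c^2-720b^2c^6+2288b^2c^5+1044b^3c^7-322b^4c^8+758b^4c^7+404b^4c^6-210b^2c^7-2464b^4c^5-2394b^3c^6+72c^4+252bc^6+3168b^6c^8+441b^5c^9-7056b^5c+57960b^6c^4-47232b^6c^3+25344b^6c^2-8064b^6c-1809b^5c^8+14472b^5c^2+3951b^5c^7-72c^5+36c^6-11808b^6c^7+1440b^5+28980b^6c^6-49032b^6c^5-4410b^5c^6+8820b^5c^4-15804b^5c^3+1152b^6-504b^6c^9-45b^3c^9-6b^4c^9+104b^2c^8+36b^6c^{10}+14b^4c^{10}-45b^5c^{10}-99bc^7$.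 These quantities arise in the study of rational perfect cuboids: the surface above parametrizes (via $b,c,w_2$) rational solutions of the cuboid factor equations. *)

(* Defs.v *)
From mathcomp Require Import all_boot all_order all_algebra.

Set Implicit Arguments.
Unset Strict Implicit.
Unset Printing Implicit Defensive.

Local Open Scope ring_scope.

Definition F (b c : rat) : rat :=
  b ^+ 2 * c ^+ 4 - 6 * b ^+ 2 * c ^+ 3 + 13 * b ^+ 2 * c ^+ 2
  - 12 * b ^+ 2 * c + 4 * b ^+ 2 + c ^+ 2.

Definition Q2 (b c : rat) : rat :=
  3 / 2 *
  (6 * b ^+ 4 * c ^+ 4 - 36 * b ^+ 4 * c ^+ 3 + 78 * b ^+ 4 * c ^+ 2
   - 72 * b ^+ 4 * c + 24 * b ^+ 4 - 12 * b ^+ 3 * c ^+ 4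
   + 36 * b ^+ 3 * c ^+ 3 - 72 * b ^+ 3 * c + 48 * b ^+ 3
   + 5 * b ^+ 2 * c ^+ 4 + 16 * b ^+ 2 * c ^+ 3 - 68 * b ^+ 2 * c ^+ 2
   + 32 * b ^+ 2 * c + 20 * b ^+ 2 - 12 * b * c ^+ 3 + 24 * b * c
   + 6 * c ^+ 2).

(* Explicit [%:R] keeps the coefficients above 5000 as abstracted nat literals;
   bare ring literals of that size overflow the stack. *)
Definition N2 (b c : rat) : rat :=
  832%:R * b ^+ 2 * c ^+ 2 - 1440%:R * b ^+ 2 * c ^+ 4
  - 840%:R * b ^+ 2 * c ^+ 3 + 4788%:R * b ^+ 3 * c ^+ 4
  + 396%:R * b * c ^+ 3 + 720%:R * b ^+ 3 * c + 808%:R * b ^+ 4 * c ^+ 4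
  + 3032%:R * b ^+ 4 * c ^+ 3 - 2576%:R * b ^+ 4 * c ^+ 2
  - 96%:R * b ^+ 4 * c + 448%:R * b ^+ 4 - 504%:R * b * c ^+ 4
  - 4176%:R * b ^+ 3 * c ^+ 3 - 9%:R * b ^+ 3 * c ^+ 8
  + 72%:R * b ^+ 3 * c ^+ 2 - 720%:R * b ^+ 2 * c ^+ 6
  + 2288%:R * b ^+ 2 * c ^+ 5 + 1044%:R * b ^+ 3 * c ^+ 7
  - 322%:R * b ^+ 4 * c ^+ 8 + 758%:R * b ^+ 4 * c ^+ 7
  + 404%:R * b ^+ 4 * c ^+ 6 - 210%:R * b ^+ 2 * c ^+ 7
  - 2464%:R * b ^+ 4 * c ^+ 5 - 2394%:R * b ^+ 3 * c ^+ 6 + 72%:R * c ^+ 4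
  + 252%:R * b * c ^+ 6 + 3168%:R * b ^+ 6 * c ^+ 8
  + 441%:R * b ^+ 5 * c ^+ 9 - 7056%:R * b ^+ 5 * c
  + 57960%:R * b ^+ 6 * c ^+ 4 - 47232%:R * b ^+ 6 * c ^+ 3
  + 25344%:R * b ^+ 6 * c ^+ 2 - 8064%:R * b ^+ 6 * c
  - 1809%:R * b ^+ 5 * c ^+ 8 + 14472%:R * b ^+ 5 * c ^+ 2
  + 3951%:R * b ^+ 5 * c ^+ 7 - 72%:R * c ^+ 5 + 36%:R * c ^+ 6
  - 11808%:R * b ^+ 6 * c ^+ 7 + 1440%:R * b ^+ 5
  + 28980%:R * b ^+ 6 * c ^+ 6 - 49032%:R * b ^+ 6 * c ^+ 5
  - 4410%:R * b ^+ 5 * c ^+ 6 + 8820%:R * b ^+ 5 * c ^+ 4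
  - 15804%:R * b ^+ 5 * c ^+ 3 + 1152%:R * b ^+ 6
  - 504%:R * b ^+ 6 * c ^+ 9 - 45%:R * b ^+ 3 * c ^+ 9
  - 6%:R * b ^+ 4 * c ^+ 9 + 104%:R * b ^+ 2 * c ^+ 8
  + 36%:R * b ^+ 6 * c ^+ 10 + 14%:R * b ^+ 4 * c ^+ 10
  - 45%:R * b ^+ 5 * c ^+ 10 - 99%:R * b * c ^+ 7.

Definition P2 (b c : rat) : rat := b * N2 b c / (2 * F b c).

Definition D2 (b c : rat) : rat := - (P2 b c ^+ 2 / Q2 b c ^+ 3).

(* Main.v *)
Require Import Defs.
From mathcomp Require Import all_boot all_order all_algebra.
From mathcomp Require Import ring.
Import GRing.Theory.

Local Open Scope ring_scope.

(** Put [x = w2^2 + 3] and [y = 2 (w2^2 - 1)]. Cleared of [Q2^3], the surface equation is the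
    cuspidal cubic [y^2 Q2^3 = P2^2 x^3]. As [w2] is not [1] or [-1], [y] is nonzero, so the point
    is not the cusp and its slope is [alpha2]. *)

(* The curve [y^2 / p^2 = (x / q)^3] is cuspidal, so a point other than the
   cusp is given by its slope [a = (y / p) / (x / q)]. *)
Lemma cuspidal_cubic_param (K : fieldType) (p q x y : K) :
    q != 0 -> y != 0 -> y ^+ 2 * q ^+ 3 = p ^+ 2 * x ^+ 3 ->
  exists a : K, x = q * a ^+ 2 /\ y = p * a ^+ 3.
Proof.
move=> q0 y0 e.
(* The equation forces [p] and [x] to be nonzero, so the slope is defined. *)
have : p ^+ 2 * x ^+ 3 != 0 by rewrite -e mulf_neq0 // expf_neq0.
rewrite mulf_eq0 !expf_eq0 /= negb_or => /andP[p0 x0].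
have px0 : p * x != 0 by rewrite mulf_neq0.
exists (y * q / (p * x)).
have a2 : x = q * (y * q / (p * x)) ^+ 2.
  rewrite expr_div_n mulrA.
  have -> : q * (y * q) ^+ 2 = x * (p * x) ^+ 2 by ring: e.
  by rewrite mulfK // expf_neq0.
split=> //.
have -> : (y * q / (p * x)) ^+ 3 = y * q / (p * x) * (x / q).
  by rewrite {3}a2 exprS [q * _]mulrC mulfK.
by field; rewrite p0 q0 x0.
Qed.

Theorem theorem2p2 (b c w2 : rat)
    (hF : F b c != 0) (hQ2 : Q2 b c != 0)
    (hsurf : D2 b c * (w2 ^+ 2 + 3) ^+ 3
               + 4 * (w2 - 1) ^+ 2 * (1 + w2) ^+ 2 = 0)
    (hw1 : w2 != 1) (hwN1 : w2 != - 1) :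
  exists alpha2 : rat,
    w2 ^+ 2 + 3 = Q2 b c * alpha2 ^+ 2 /\
    2 * (w2 ^+ 2 - 1) = P2 b c * alpha2 ^+ 3.
Proof.
move: hsurf; rewrite /D2; move: (P2 b c) (Q2 b c) hQ2 => p q q0 hsurf.
apply: cuspidal_cubic_param => //.
  have -> : 2 * (w2 ^+ 2 - 1) = 2 * ((w2 - 1) * (w2 + 1)) by ring.
  by rewrite !mulf_neq0 // ?subr_eq0 ?addr_eq0.
(* The difference of the two sides is [q^3] times the left side of [hsurf]. *)
apply/eqP; rewrite -subr_eq0 -(mulr0 (q ^+ 3)) -hsurf; apply/eqP.
by field.
Qed.
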